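(* Let $H_1^{\le},\dots,H_r^{\le}\subseteq\mathbb{R}^n$ be affine halfspaces with boundary hyperplanes $H_1,\dots,H_r$, and let $\mathcal{R}\subseteq\mathbb{R}^n\times\mathbb{R}^n$ be the polyhedral relation induced by the sequence $(R_{H_1^{\le}},\dots,R_{H_r^{\le}})$ of reflection relations. Let $P,Q\subseteq\mathbb{R}^n$ be polytopes with $Q=\operatorname{conv}(W)$ for some $W\subseteq\mathbb{R}^n$. Suppose that the following two conditions hold: (1) $P\subseteq Q$ and $\varrho^{(H_i)}(Q)\subseteq Q$ for all $i\in\{1,\dots,r\}$; (2) $\varrho^{\star(H_1^{\le})}\circ\cdots\circ\varrho^{\star(H_r^{\le})}(w)\in P$ for all $w\in W$. Then $Q=\mathcal{R}(P)$.
   Context: For $a\in\mathbb{R}^n\setminus\{0\}$ and $\beta\in\mathbb{R}$ let $H=\{x\in\mathbb{R}^n:\langle a,x\rangle=\beta\}$ and $H^{\le}=\{x\in\mathbb{R}^n:\langle a,x\rangle\le\beta\}$, and let $H^{\perp}=\{\lambda a:\lambda\in\mathbb{R}\}$. The map $\varrho^{(H)}:\mathbb{R}^n\to\mathbb{R}^n$ is the orthogonal reflection at $H$: $\varrho^{(H)}(x)-x\in H^\perp$ and $\langle a,\varrho^{(H)}(x)\rangle=2\beta-\langle a,x\rangle$. The reflection relation defined by $H^{\le}$ is $$R_{H^{\le}}=\{(x,y)\in\mathbb{R}^n\times\mathbb{R}^n: y-x\in H^{\perp},\ \langle a,x\rangle\le\langle a,y\rangle\le 2\beta-\langle a,x\rangle\}$$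 (independent of positive rescaling of $(a,\beta)$). The map $\varrho^{\star(H^{\le})}:\mathbb{R}^n\to\mathbb{R}^n$ is defined by $\varrho^{\star(H^{\le})}(y)=y$ if $y\in H^{\le}$ and $\varrho^{\star(H^{\le})}(y)=\varrho^{(H)}(y)$ otherwise. The relation induced by a sequence $(R_1,\dots,R_r)$ of polyhedra $R_i\subseteq\mathbb{R}^n\times\mathbb{R}^n$ is the set $\mathcal{R}$ of all $(z^{(0)},z^{(r)})\in\mathbb{R}^n\times\mathbb{R}^n$ for which there are $z^{(1)},\dots,z^{(r-1)}\in\mathbb{R}^n$ with $(z^{(i-1)},z^{(i)})\in R_i$ for all $i\in\{1,\dots,r\}$. For a relation $R\subseteq\mathbb{R}^n\times\mathbb{R}^n$ and $X\subseteq\mathbb{R}^n$, $R(X)=\{y\in\mathbb{R}^n:(x,y)\in R\text{ for some }x\in X\}$. *)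

(* Defs.v *)
From mathcomp Require Import all_boot all_order all_algebra.
From mathcomp Require Import boolp classical_sets functions cardinality reals.
From mathcomp Require Import convex.

Set Implicit Arguments.
Unset Strict Implicit.
Unset Printing Implicit Defensive.

Import Order.TTheory GRing.Theory Num.Theory.

Local Open Scope classical_set_scope.
Local Open Scope ring_scope.

Definition inner (R : realType) (n : nat) (u v : 'rV[R]_n) : R :=
  \sum_(j < n) u 0 j * v 0 j.

(* An affine halfspace H^<= and its boundary hyperplane H = {x | <a, x> = beta}
   are both represented by a pair (a, beta), with a != 0. *)
Definition halfspace (R : realType) (n : nat) (a : 'rV[R]_n) (beta : R) :
    set 'rV[R]_n :=
  [set x | inner a x <= beta].

Definition hperp (R : realType) (n : nat) (a : 'rV[R]_n) : set 'rV[R]_n :=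
  range (fun lambda : R => lambda *: a).

(* Closed form of the orthogonal reflection at H; [reflectionP] shows that it
   is, for a != 0, the unique map satisfying the defining conditions. *)
Definition reflection (R : realType) (n : nat) (a : 'rV[R]_n) (beta : R)
    (x : 'rV[R]_n) : 'rV[R]_n :=
  x + (2 * (beta - inner a x) / inner a a) *: a.

Definition reflection_relation (R : realType) (n : nat) (a : 'rV[R]_n)
    (beta : R) : set ('rV[R]_n * 'rV[R]_n) :=
  [set xy | hperp a (xy.2 - xy.1) /\
            inner a xy.1 <= inner a xy.2 <= 2 * beta - inner a xy.1].

Definition cond_reflection (R : realType) (n : nat) (a : 'rV[R]_n) (beta : R)
    (y : 'rV[R]_n) : 'rV[R]_n :=
  if y \in halfspace a beta then y else reflection a beta y.

(* f 0 \o f 1 \o ... \o f (r - 1): the map with the largest index is applied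
   first. *)
Definition compose_all (T : Type) (r : nat) (f : 'I_r -> T -> T) : T -> T :=
  \big[(fun g h : T -> T => g \o h)/idfun]_(i < r) f i.

(* Only z 0, ..., z r matter, and S i, with i counted from 0, relates z i to
   z i.+1. *)
Definition induced_relation (T : Type) (r : nat) (S : 'I_r -> set (T * T)) :
    set (T * T) :=
  [set xy | exists z : nat -> T,
     [/\ z 0%N = xy.1, z r = xy.2 & forall i : 'I_r, S i (z i, z i.+1)]].

Definition relation_image (T : Type) (S : set (T * T)) (X : set T) : set T :=
  [set y | exists2 x, X x & S (x, y)].

Definition convex_hull (R : realType) (n : nat) (X : set 'rV[R]_n) : set 'rV[R]_n :=
  smallest (@convex_set R 'rV[R]_n) X.

Definition polytope (R : realType) (n : nat) (X : set 'rV[R]_n) : Prop :=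
  exists2 V : set 'rV[R]_n, finite_set V & X = convex_hull V.

Lemma innerDZr (R : realType) (n : nat) (a x : 'rV[R]_n) (k : R) :
  inner a (x + k *: a) = inner a x + k * inner a a.
Proof.
rewrite /inner mulr_sumr -big_split; apply: eq_bigr => j _ /=.
by rewrite !mxE mulrDr mulrCA.
Qed.

Lemma inner_neq0 (R : realType) (n : nat) (a : 'rV[R]_n) :
  a != 0 -> inner a a != 0.
Proof.
apply: contraNN; rewrite /inner psumr_eq0 => [/allP a0|j _]; last first.
  by rewrite -expr2 sqr_ge0.
apply/eqP/rowP => j; rewrite mxE.
by have := a0 j (mem_index_enum j); rewrite mulf_eq0 orbb => /eqP.
Qed.

Lemma reflectionP (R : realType) (n : nat) (a : 'rV[R]_n) (beta : R)
    (x y : 'rV[R]_n) :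
  a != 0 ->
  y = reflection a beta x <->
  hperp a (y - x) /\ inner a y = 2 * beta - inner a x.
Proof.
move=> a0; have aa0 := inner_neq0 a0; split=> [->|[[k _ kE]]].
  split.
    by exists (2 * (beta - inner a x) / inner a a) => //;
      rewrite addrAC subrr add0r.
  rewrite innerDZr divfK // mulrBr addrCA; congr (_ + _).
  by rewrite mulr_natl mulr2n opprD addrA subrr add0r.
have -> : y = x + k *: a by rewrite kE addrC subrK.
rewrite innerDZr /reflection => E; congr (_ + _ *: _).
apply: (mulIf aa0); rewrite divfK //.
apply: (addrI (inner a x)); rewrite E mulrBr addrCA; congr (_ + _).
by rewrite mulr_natl mulr2n opprD addrA subrr add0r.
Qed.

(* Main.v *)
(* Each R_{H_i} is convex, so R(P) is convex, and it contains W since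
   (rho*(y), y) lies in R_H for every y; hence conv(W) is contained in R(P).
   Conversely, the points related to x by R_H form the segment from x to its
   reflection (or there are none), so Q is closed under each R_{H_i}. *)

Require Import Defs.
From mathcomp Require Import all_boot all_order all_algebra.
From mathcomp Require Import boolp classical_sets functions cardinality reals.
From mathcomp Require Import convex.
From mathcomp Require Import interval_inference ring lra.

Set Implicit Arguments.
Unset Strict Implicit.
Unset Printing Implicit Defensive.

Import Order.TTheory GRing.Theory Num.Theory.

Local Open Scope classical_set_scope.
Local Open Scope ring_scope.

(** Trades the bundled unit-interval parameter of [convex_set] for a bare real [t] with bounds, so
    that explicit weights can be supplied. *)
Lemma convex_setP (R : realType) (M : lmodType R) (A : set M) :
  convex_set A <->
  forall (x y : M) (t : R), 0 <= t <= 1 -> A x -> A y ->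
    A (t *: x + (1 - t) *: y).
Proof.
split=> [cA x y t /andP[t0 t1] /mem_set Ax /mem_set Ay|cA x y t].
  exact: set_mem (cA x y (Itv01 t0 t1) Ax Ay).
move=> /set_mem Ax /set_mem Ay; apply: mem_set.
by apply: (cA x y t%:num) => //; rewrite ge0 le1.
Qed.

Lemma convex_hull_convex (R : realType) (n : nat) (X : set 'rV[R]_n) :
  convex_set (convex_hull X).
Proof.
apply/convex_setP => x y t t01 Xx Xy A [/= cA XA].
by move/convex_setP: (cA); apply=> //; [exact: Xx|exact: Xy].
Qed.

Lemma polytope_convex (R : realType) (n : nat) (X : set 'rV[R]_n) :
  polytope X -> convex_set X.
Proof. by move=> [V _ ->]; exact: convex_hull_convex. Qed.

Lemma inner_conv (R : realType) (n : nat) (a x y : 'rV[R]_n) (s t : R) :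
  inner a (s *: x + t *: y) = s * inner a x + t * inner a y.
Proof.
rewrite /inner !mulr_sumr -big_split; apply: eq_bigr => j _ /=.
by rewrite !mxE; ring.
Qed.

Lemma inner_ge0 (R : realType) (n : nat) (a : 'rV[R]_n) : 0 <= inner a a.
Proof. by apply: sumr_ge0 => j _; rewrite -expr2 sqr_ge0. Qed.

Lemma inner_reflection (R : realType) (n : nat) (a : 'rV[R]_n) (beta : R)
    (x : 'rV[R]_n) :
  a != 0 -> inner a (reflection a beta x) = 2 * beta - inner a x.
Proof. by move=> a0; have [] := (reflectionP beta x _ a0).1 erefl. Qed.

Lemma reflection_relation_segment (R : realType) (n : nat) (a : 'rV[R]_n)
    (beta : R) (x y : 'rV[R]_n) :
  a != 0 -> reflection_relation a beta (x, y) ->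
  exists2 t : R, 0 <= t <= 1 & y = t *: reflection a beta x + (1 - t) *: x.
Proof.
move=> a0 [/= [k _ kE]].
have -> : y = x + k *: a by rewrite kE addrC subrK.
have aa0 : 0 < inner a a by rewrite lt0r inner_neq0 // inner_ge0.
rewrite innerDZr /reflection; set d := beta - inner a x => /andP[ge_x le_x].
have k0 : 0 <= k by rewrite -(pmulr_lge0 _ aa0); lra.
have kd : k * inner a a <= 2 * d by rewrite /d; lra.
(* If [d <= 0], the bounds [k0] and [kd] force [k = 0]; this also absorbs the contradictory case
   [d < 0]. Afterwards [d] may be divided by. *)
have [d0|d0] := leP d 0.
  have -> : k = 0.
    apply/eqP; rewrite eq_le k0 andbT -(pmulr_lle0 _ aa0).
    by apply: (le_trans kd); lra.
  by exists 0; rewrite ?lexx ?ler01 // !scale0r subr0 scale1r add0r addr0.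
(* The reflection moves [x] by [2 * d / inner a a] times [a]; the weight is the ratio of [k] to this
   coefficient. *)
exists (k * inner a a / (2 * d)).
  apply/andP; split; last by rewrite ler_pdivrMr ?mul1r //; lra.
  by rewrite divr_ge0 ?mulr_ge0 ?inner_ge0 //; lra.
rewrite scalerDr addrAC -scalerDl scalerA subrKC scale1r; congr (_ + _ *: _).
by field; rewrite gt_eqF //= gt_eqF.
Qed.

(** Inside the halfspace the pair is [(y, y)], and the upper bound is just [inner a y <= beta].
    Outside, [y] is the mirror image of the reflected point, so the upper bound is attained. *)
Lemma cond_reflection_related (R : realType) (n : nat) (a : 'rV[R]_n)
    (beta : R) (y : 'rV[R]_n) :
  a != 0 -> reflection_relation a beta (cond_reflection a beta y, y).
Proof.
move=> a0; rewrite /cond_reflection; case: ifPn => [/set_mem|/negP yH].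
  rewrite /halfspace /= => yH; split; last by apply/andP; split => /=; lra.
  by exists 0; rewrite ?scale0r ?subrr.
have {}yH : beta < inner a y.
  by rewrite ltNge; apply/negP => ?; apply: yH; exact: mem_set.
split => /=; last by rewrite inner_reflection //; apply/andP; split; lra.
(* Going back from the reflected point to [y] reverses the displacement. *)
exists (- (2 * (beta - inner a y) / inner a a)) => //.
by rewrite scaleNr /reflection opprD addNKr.
Qed.

(** The chain is built backwards from its endpoint [y]: its i-th point is the composite of the maps
    with index at least [i], applied to [y]. *)
Lemma induced_relation_compose_all (T : Type) (r : nat)
    (S : 'I_r -> set (T * T)) (f : 'I_r -> T -> T) (y : T) :
  (forall i x, S i (f i x, x)) -> induced_relation S (compose_all f y, y).
Proof.
elim: r S f => [|r IHr] S f Sf.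
  by exists (fun=> y); split=> [||[]] //=; rewrite /compose_all big_ord0.
have [//|z [/= z0 zr zS]] :=
  IHr (fun i => S (lift ord0 i)) (fun i => f (lift ord0 i)).
(* The chain for the last [r] maps is shifted by one and its new head is the image of the old head
   under the outermost map. *)
exists (fun i => if i is j.+1 then z j else f ord0 (z 0%N)); split=> //=.
  by rewrite z0 /compose_all big_ord_recl.
by move=> i; case: (unliftP ord0 i) => [j ->|->] //=; exact: zS.
Qed.

Lemma induced_relation_invariant (T : Type) (r : nat)
    (S : 'I_r -> set (T * T)) (A : set T) (x y : T) :
  (forall i u v, S i (u, v) -> A u -> A v) ->
  induced_relation S (x, y) -> A x -> A y.
Proof.
move=> SA [z [/= <- <- zS]] Az0.
suff H k : (k <= r)%N -> A (z k) by exact: H.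
by elim: k => // k IHk kr; apply: SA (zS (Ordinal kr)) (IHk (ltnW kr)).
Qed.

Lemma reflection_relation_conv (R : realType) (n : nat) (a : 'rV[R]_n)
    (beta t : R) (x y x' y' : 'rV[R]_n) :
  0 <= t <= 1 ->
  reflection_relation a beta (x, y) -> reflection_relation a beta (x', y') ->
  reflection_relation a beta
    (t *: x + (1 - t) *: x', t *: y + (1 - t) *: y').
Proof.
move=> /andP[t0 t1] [/= [k _ kE] /andP[xy yx]] [/= [k' _ kE'] /andP[xy' yx']].
split=> /=.
  exists (t * k + (1 - t) * k') => //.
  by rewrite scalerDl -!scalerA kE kE' !scalerBr opprD addrACA.
rewrite !inner_conv; apply/andP; split.
  by rewrite lerD // ler_wpM2l // subr_ge0.
(* The constant [2 * beta] is preserved because the weights sum to 1. *)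
have := lerD (ler_wpM2l t0 yx) (ler_wpM2l (_ : 0 <= 1 - t) yx').
by rewrite subr_ge0 => /(_ t1); lra.
Qed.

(** Two chains are mixed index by index with one common weight [t]; each link survives by convexity
    of [S i], and the start stays in [A]. *)
Lemma relation_image_convex (R : realType) (M : lmodType R) (r : nat)
    (S : 'I_r -> set (M * M)) (A : set M) :
  (forall i (t : R) x y x' y', 0 <= t <= 1 -> S i (x, y) -> S i (x', y') ->
     S i (t *: x + (1 - t) *: x', t *: y + (1 - t) *: y')) ->
  convex_set A -> convex_set (relation_image (induced_relation S) A).
Proof.
move=> cS /convex_setP cA; apply/convex_setP.
move=> y y' t t01 [x Ax [z [/= z0 zr zS]]] [x' Ax' [z' [/= z'0 z'r z'S]]].
exists (t *: x + (1 - t) *: x'); first exact: cA.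
exists (fun i => t *: z i + (1 - t) *: z' i).
by split=> [||i]; rewrite /= ?z0 ?z'0 ?zr ?z'r //; exact: cS.
Qed.

Theorem theorem1 (R : realType) (n r : nat)
    (a : 'I_r -> 'rV[R]_n) (beta : 'I_r -> R) (P Q W : set 'rV[R]_n)
    (ha : forall i : 'I_r, a i != 0)
    (hP : polytope P) (hQ : polytope Q) (hQW : Q = convex_hull W)
    (h1 : P `<=` Q /\
          forall i : 'I_r, reflection (a i) (beta i) @` Q `<=` Q)
    (h2 : forall w : 'rV[R]_n, W w ->
          P (compose_all (fun i : 'I_r => cond_reflection (a i) (beta i)) w)) :
  Q = relation_image
        (induced_relation
           (fun i : 'I_r => reflection_relation (a i) (beta i))) P.
Proof.
have [PQ reflQ] := h1; apply/seteqP; split.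
  rewrite hQW; apply: smallest_sub.
    apply: relation_image_convex; last exact: polytope_convex.
    by move=> i t x y x' y'; exact: reflection_relation_conv.
  move=> w Ww.
  exists (compose_all (fun i => cond_reflection (a i) (beta i)) w).
    exact: h2.
  apply: induced_relation_compose_all => i x.
  exact: cond_reflection_related.
move=> y [x /PQ Qx xy]; apply: induced_relation_invariant xy Qx => i u v uv Qu.
(* Both ends of the segment, [u] and its reflection, lie in the convex set [Q]. *)
have [t t01 ->] := reflection_relation_segment (ha i) uv.
move/convex_setP: (polytope_convex hQ); apply=> //.
by apply: reflQ; exists u.
Qed.
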